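(* For each integer $k\geq 5$, the equation $$4x^{k-2}=\frac{x^k-1}{x-1}$$ has a unique real solution with $x>2$, denoted $\gamma_k$. For $2<\beta<\gamma_5\approx 2.28879$ we have $\bar{d}^{(\beta E)}(\beta)=1$, but: (a) for $\gamma_6\leq\beta\leq\gamma_5$, $\bar{d}^{(bdd)}(\beta)\leq\frac{9}{10}$; (b) for $\gamma_{k+1}\leq\beta\leq\gamma_k$ with $k\geq 6$, $\bar{d}^{(bdd)}(\beta)\leq\frac{k+2}{k+3}$.
   Context: Let $\beta\in\mathbb{R}_{>1}$ and $J\in\mathbb{Z}\cup\{-\infty\}$. Let $\mathcal{B}_J$ be the set of bounded sequences $\{d_j\}_{j\ge J}$ (indexed by integers $j\geq J$, or by all integers if $J=-\infty$) with $d_j\in\mathbb{Z}_{\geq 0}$ and, if $J=-\infty$, with only finitely many nonzero $d_j$ for negative $j$. The bound on the sequence is not specified a priori. Define $$\bar{d}^{(bdd)}_J(\beta,u)=\inf_{\{d_j\}\in\mathcal{B}_J}\Big\{\limsup_{k\to\infty}\frac1k\sum_{j=J}^{k}d_j \;:\; u=\sum_{j=J}^\infty\frac{d_j}{\beta^j}\Big\},\qquad \bar{d}^{(bdd)}(\beta)=\sup_{u\in\mathbb{R}_{>0}}\bar{d}^{(bdd)}_J(\beta,u).$$ The beta expansion (greedy expansion) of $u\in\mathbb{R}_{>0}$ starting at $J$ is the unique sequence of non-negative integers $\{d_j\}_{j\geq J}$ with $u=\sum_{j=J}^\infty d_j\beta^{-j}$ such that the remainders $r_k=u-\sum_{j=J}^k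 d_j\beta^{-j}$ satisfy $0\leq r_k<\beta^{-k}$ for all $k\geq J$ (all $k\in\mathbb{Z}$ if $J=-\infty$). Its $j$th digit is denoted $d_{j,J}^{(\beta E)}(\beta,u)$, and $$\bar{d}^{(\beta E)}(\beta)=\sup_{u\in\mathbb{R}_{>0}}\limsup_{k\to\infty}\frac1k\sum_{j=J}^k d_{j,J}^{(\beta E)}(\beta,u).$$ The values $\bar{d}^{(bdd)}(\beta)$ and $\bar{d}^{(\beta E)}(\beta)$ do not depend on the choice of $J$. *)

(* Defs.v *)
From HB Require Import structures.
From mathcomp Require Import all_boot all_order all_algebra.
From mathcomp Require Import all_classical all_reals all_analysis.

Set Implicit Arguments.
Unset Strict Implicit.
Unset Printing Implicit Defensive.
Import Order.TTheory GRing.Theory Num.Theory.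
Local Open Scope classical_set_scope.
Local Open Scope ring_scope.

(* The starting index J in Z \cup {-oo} is an [option int], [None] being -oo. *)
Definition indices (J : option int) : set int :=
  if J is Some j0 then [set j | j0 <= j] else setT.

Definition indices_upto (J : option int) (k : int) : set int :=
  [set j | indices J j /\ j <= k].

(* A sequence indexed by [indices J] is a function on all of int that vanishes
   outside [indices J], so that distinct functions are distinct sequences. *)
Definition supported_on (J : option int) (d : int -> nat) : Prop :=
  forall j, ~ indices J j -> d j = 0%N.

Definition bounded_digits (J : option int) : set (int -> nat) :=
  [set d | [/\ supported_on J d,
               exists M : nat, forall j, (d j <= M)%N
             & J = None -> finite_set [set j | j < 0 /\ d j <> 0%N]]].

(* All terms are nonnegative, so [\esum] is the usual sum of the series, with
   value +oo in case of divergence (also at the -oo end when J = -oo). *)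
Definition expansion_sum (R : realType) (J : option int) (beta : R)
    (d : int -> nat) : \bar R :=
  \esum_(j in indices J) ((d j)%:R / beta ^ j)%:E.

Definition remainder (R : realType) (J : option int) (beta u : R)
    (d : int -> nat) (k : int) : \bar R :=
  (u%:E - \esum_(j in indices_upto J k) ((d j)%:R / beta ^ j)%:E)%E.

Definition upper_average (R : realType) (J : option int)
    (d : int -> nat) : \bar R :=
  limn_esup (fun k : nat =>
    ((k%:R^-1)%:E *
      \esum_(j in indices_upto J k%:Z) ((d j)%:R : R)%:E)%E).

Definition dbar_bdd_at (R : realType) (J : option int) (beta u : R) : \bar R :=
  ereal_inf [set upper_average R J d | d in
    [set d | bounded_digits J d /\ u%:E = expansion_sum J beta d]].

Definition dbar_bdd (R : realType) (J : option int) (beta : R) : \bar R :=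
  ereal_sup [set dbar_bdd_at J beta u | u in [set u : R | 0 < u]].

Definition is_beta_expansion (R : realType) (J : option int) (beta u : R)
    (d : int -> nat) : Prop :=
  [/\ supported_on J d,
      u%:E = expansion_sum J beta d
    & forall k, indices J k ->
        (0 <= remainder J beta u d k < (beta ^ (- k))%:E)%E].

(* For 1 < beta and 0 < u there is exactly one such sequence, which [get]
   therefore returns. *)
Definition beta_digits (R : realType) (J : option int) (beta u : R) :
    int -> nat :=
  get (is_beta_expansion J beta u).

Definition dbar_betaE (R : realType) (J : option int) (beta : R) : \bar R :=
  ereal_sup [set upper_average R J (beta_digits J beta u) | u in
    [set u : R | 0 < u]].

Definition gamma_equation (R : realType) (k : nat) (x : R) : Prop :=
  4 * x ^+ (k - 2) = (x ^+ k - 1) / (x - 1).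

(* Meaningful for 5 <= k, where the solution exists and is unique. *)
Definition gamma (R : realType) (k : nat) : R :=
  xget 0 [set x : R | 2 < x /\ gamma_equation k x].

(* Main.v *)
Require Import Defs.
From HB Require Import structures.
From mathcomp Require Import all_boot all_order all_algebra.
From mathcomp Require Import all_classical all_reals all_analysis.
From mathcomp Require Import ring lra zify.
Set Implicit Arguments.
Unset Strict Implicit.
Unset Printing Implicit Defensive.
Import Order.TTheory GRing.Theory Num.Theory.
Import numFieldNormedType.Exports.
Local Open Scope classical_set_scope.
Local Open Scope ring_scope.

(** For x > 2 the equation defining gamma_k reads (x - 2)^2 x^(k-2) = 1, whose left-hand side is
    increasing in x.

    Greedy digits.  When 2 < beta < 1 + sqrt 2 a digit 2 leaves a scaled remainder less than
    beta - 2, and beta (beta - 2) < 1, so the next digit is 0 and the digit sum of a greedy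
    expansion exceeds its length by a bounded amount only.  The digits 1, 1, 1, ... are greedy, so
    the average 1 is attained.

    Bounded digits.  From every scaled remainder in [0, 1[ there is a block of at most N digits
    with digit sum less than its length that leads back to [0, 1[; concatenating such blocks
    gives an average of at most (N - 1) / N.  Take greedy digits until a digit other than 1
    occurs.  A digit 0 ends the block.  A digit 2 is followed by 00 if k >= 6, and by 00, 010 or
    0110 if k = 5.  If instead k + 1 digits 1 occur, they are traded for 0 4 0 ... 0 e with
    e in {0, 1}, which is possible exactly because gamma_(k+1) <= beta <= gamma_k.  Hence
    N = k + 3 if k >= 6, and N = 10 if k = 5. *)

(** * The numbers gamma_k *)

Section Gamma.
Context {R : realType}.
Implicit Types (x y beta : R) (k : nat).

(* Clearing denominators in the equation gives x ^ k - 4 x ^ (k-1) + 4 x ^ (k-2) = 1. *)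
Lemma gamma_equationP k x : 2 < x ->
  gamma_equation k.+2 x <-> (x - 2) ^+ 2 * x ^+ k = 1.
Proof.
move=> x2; have x10 : x - 1 != 0 by apply/eqP; lra.
rewrite /gamma_equation !subSS subn0 !exprS.
move: (x ^+ k) => p; split=> [/(congr1 ( *%R^~ (x - 1)))|h].
  by rewrite divfK// => e; lra.
by apply: (mulIf x10); rewrite divfK//; lra.
Qed.

Lemma gamma_poly_lt k x y : 2 <= x -> x < y ->
  (x - 2) ^+ 2 * x ^+ k < (y - 2) ^+ 2 * y ^+ k.
Proof.
move=> x2 xy; have x0 : 0 < x by lra.
apply: (@le_lt_trans _ _ ((x - 2) ^+ 2 * y ^+ k)).
  by rewrite ler_wpM2l ?sqr_ge0// lerXn2r ?nnegrE ?(ltW xy)// ltW// (lt_trans x0).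
by rewrite ltr_pM2r ?exprn_gt0 ?(lt_trans x0)// !expr2; nra.
Qed.

Lemma gamma_poly_leE k x y : 2 <= x -> 2 <= y ->
  ((x - 2) ^+ 2 * x ^+ k <= (y - 2) ^+ 2 * y ^+ k) = (x <= y).
Proof.
move=> x2 y2; case: (leP x y) => [|yx].
  by rewrite le_eqVlt => /predU1P[->|/gamma_poly_lt/ltW]; rewrite ?lexx//; apply.
by apply/negbTE; rewrite -ltNge gamma_poly_lt.
Qed.

(** Existence is the intermediate value theorem on [2, 3], where the polynomial goes from -1 to 3^k
    - 1; uniqueness is monotonicity. *)
Lemma gamma_exists_unique k : exists! x, 2 < x /\ gamma_equation k.+2 x.
Proof.
pose p : {poly R} := ('X - 2%:P) ^+ 2 * 'X^k - 1.
have pE x : p.[x] = (x - 2) ^+ 2 * x ^+ k - 1 by rewrite !hornerE.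
have [||x /andP[x2 x3] /eqP] := @poly_ivt R p 2 3.
- by lra.
- rewrite !pE subrr expr0n mul0r sub0r oppr_le0 ler01/= subr_ge0.
  rewrite (_ : 3 - 2 = 1 :> R) ?expr1n ?mul1r; last by lra.
  by rewrite exprn_ege1//; lra.
rewrite pE => /subr0_eq px.
have {}x2 : 2 < x.
  rewrite lt_neqAle x2 andbT; apply/eqP => x2E.
  by move: px; rewrite -x2E subrr expr0n mul0r => /esym/eqP; rewrite oner_eq0.
exists x; split=> [|y [y2]]; first by split=> //; apply/gamma_equationP.
move=> /(gamma_equationP _ y2) py.
have [x2' y2'] : 2 <= x /\ 2 <= y by rewrite !ltW.
by apply/eqP; rewrite eq_le -(gamma_poly_leE k x2' y2') -(gamma_poly_leE k y2' x2') px py lexx.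
Qed.

Lemma gamma_spec k : 2 < gamma R k.+2 /\ gamma_equation k.+2 (gamma R k.+2).
Proof.
have [x [Px _]] := gamma_exists_unique k.
exact: (@xgetI _ _ [set x | 2 < x /\ gamma_equation k.+2 x] x Px).
Qed.

Lemma gamma_gt2 k : 2 < gamma R k.+2. Proof. by case: (gamma_spec k). Qed.

Lemma gammaP k : (gamma R k.+2 - 2) ^+ 2 * gamma R k.+2 ^+ k = 1.
Proof.
by apply/gamma_equationP; case: (gamma_spec k).
Qed.

(** Turns a comparison with the implicitly defined root into a polynomial inequality in [x]
    alone. *)
Lemma le_gammaE k x : 2 <= x ->
  (x <= gamma R k.+2) = ((x - 2) ^+ 2 * x ^+ k <= 1).
Proof. by move=> x2; rewrite -[X in _ = (_ <= X)](gammaP k) gamma_poly_leE// ltW// gamma_gt2. Qed.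

Lemma gamma_leE k x : 2 <= x ->
  (gamma R k.+2 <= x) = (1 <= (x - 2) ^+ 2 * x ^+ k).
Proof. by move=> x2; rewrite -[X in _ = (X <= _)](gammaP k) gamma_poly_leE// ltW// gamma_gt2. Qed.

Lemma gamma5_approx :
  `|gamma R 5 - (2 + 288 / 10 ^+ 3 + 79 / 10 ^+ 5)| < 5 / 10 ^+ 6.
Proof.
have lo : 2 + 288 / 10 ^+ 3 + 785 / 10 ^+ 6 < gamma R 5.
  by rewrite ltNge gamma_leE; [rewrite -ltNge; lra|lra].
have hi : gamma R 5 < 2 + 288 / 10 ^+ 3 + 795 / 10 ^+ 6.
  by rewrite ltNge le_gammaE; [rewrite -ltNge; lra|lra].
by rewrite ltr_norml; apply/andP; split; lra.
Qed.

End Gamma.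

(** * Blocks of digits *)

Section Blocks.
Context {R : realType} (beta : R).
Implicit Types (x y : R) (k m n s d N : nat).

(* [reach n s x]: some n digits of sum s bring the remainder x back to [0, 1[. *)
Inductive reach : nat -> nat -> R -> Prop :=
| reach_done x : 0 <= x < 1 -> reach 0 0 x
| reach_step n s d x : (d <= 4)%N -> reach n s (beta * x - d%:R) ->
    reach n.+1 (d + s) x.

Lemma reach_ones n x m s :
  reach m s (beta ^+ n * x - \sum_(i < n) beta ^+ i) -> reach (n + m) (n + s) x.
Proof.
elim: n x => [|n IH] x /=; first by rewrite big_ord0 subr0 expr0 mul1r.
move=> h; rewrite !addSn -[(n + s).+1]add1n.
apply: reach_step => //; apply: IH.
by move: h; congr (reach _ _ _); rewrite big_ord_recr exprS/=; ring.
Qed.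

Lemma reach_zeros n x m s : reach m s (beta ^+ n * x) -> reach (n + m) s x.
Proof.
elim: n x => [|n IH] x /=; first by rewrite expr0 mul1r.
move=> h; rewrite addSn -[s]add0n; apply: reach_step => //; apply: IH.
by rewrite subr0 mulrA -exprSr.
Qed.

Hypothesis beta2 : 2 < beta.

(** Read backwards, a digit replaces [x] by (x + d) / beta, and (5 + 4) / 2 < 5. This uniform bound
    later makes the remainders tend to 0. *)
Lemma reach_bounded n s x : reach n s x -> 0 <= x <= 5.
Proof.
elim=> {n s x} [x|n s d x d4 _]; first by lra.
have : d%:R <= 4%:R :> R by rewrite ler_nat.
have : 0 <= d%:R :> R by [].
move: beta2 d%:R => b2 e e0 e4 h; apply/andP; split; nra.
Qed.

Hypothesis beta3 : beta <= 3.

Lemma greedy_digit x : 0 <= x < 1 ->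
  [\/ 0 <= beta * x < 1, 0 <= beta * x - 1 < 1 | 0 <= beta * x - 2 < beta - 2].
Proof.
move=> x01; have b2 := beta2; have b3 := beta3.
have [?|?] := ltP (beta * x) 1; first by constructor 1; apply/andP; split; nra.
have [?|?] := ltP (beta * x) 2; first by constructor 2; lra.
by constructor 3; apply/andP; split; nra.
Qed.

(** The conclusion asks for at most [N] digits with sum strictly below their number. After a 2, the
    tail must save two units: one for the excess of the 2, one for strictness. *)
Lemma block_exists k N x : (k < N)%N ->
  (forall y, 0 <= y < beta - 2 ->
     exists n s, [/\ (n + k < N)%N, (s + 2 <= n)%N & reach n s y]) ->
  (forall y, 0 <= beta ^+ k.+1 * y - \sum_(i < k.+1) beta ^+ i < 1 ->
     exists2 s, (s <= k)%N & reach k.+1 s y) ->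
  0 <= x < 1 -> exists n s, [/\ (n < N)%N, (s <= n)%N & reach n.+1 s x].
Proof.
move=> kN after2 ones x01.
set goal := (exists n, _).
(* Induction on the number [i] of leading digits 1: either a block has been found, or the remainder
   is still in [0, 1[ after [i] ones. *)
suff h i : (i <= k.+1)%N ->
    goal \/ 0 <= beta ^+ i * x - \sum_(j < i) beta ^+ j < 1.
  have [//|/ones[s sk rs]] := h _ (leqnn k.+1).
  by exists k, s.
elim: i => [_|i IH ik]; first by right; rewrite big_ord0 expr0 mul1r subr0.
have [?|y01] := IH (ltnW ik); first by left.
have := greedy_digit y01.
have -> : beta ^+ i.+1 * x - \sum_(j < i.+1) beta ^+ j =
    beta * (beta ^+ i * x - \sum_(j < i) beta ^+ j) - 1.
  rewrite big_ord_recl/= mulrBr mulr_sumr mulrA -exprS expr0.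
  rewrite opprD addrA addrAC; congr (_ - _ - _).
  by apply: eq_bigr => j _; rewrite exprS.
case=> [y0|y1|y2]; [left| by right|left].
- exists i, i; split=> //; first exact: leq_trans kN.
  rewrite -[i.+1]addn1 -[X in reach _ X]addn0; apply: reach_ones.
  by apply: (@reach_step 0 0 0) => //; apply: reach_done; rewrite subr0.
- have [n [s [nk sn rn]]] := after2 _ y2.
  exists (i + n)%N, (i + (2 + s))%N; split; [lia|lia|].
  by rewrite -addnS; apply: reach_ones; apply: reach_step.
Qed.

(* The digits 1 ^ (k + 1) are traded for 0 4 0 ^ (k - 2) e with e in {0, 1}: the values
   differ by (beta ^ (k-1) (beta - 2) ^ 2 - 1) / (beta - 1), which is in [0, 1]. *)
Lemma trade_ones k y : (5 <= k)%N ->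
  1 <= (beta - 2) ^+ 2 * beta ^+ k.-1 <= beta ->
  0 <= beta ^+ k.+1 * y - \sum_(i < k.+1) beta ^+ i < 1 ->
  exists2 s, (s <= k)%N & reach k.+1 s y.
Proof.
move=> k5; have -> : k = (k - 2).+2 by lia.
set m := (k - 2)%N => /= bm.
set S := \sum_(_ < _) _ => yS.
have b2 := beta2.
have SE : (beta - 1) * S = beta ^+ m.+3 - 1 by rewrite subrX1.
have [dlo dhi] : 0 <= S - 4 * beta ^+ m.+1 /\ S - 4 * beta ^+ m.+1 <= 1.
  move: SE bm; rewrite !exprS; move: (beta ^+ m) => p SE bm.
  split; rewrite -(ler_pM2l (_ : 0 < beta - 1)); nra.
have rest e : 0 <= beta ^+ m.+3 * y - 4 * beta ^+ m.+1 - e%:R < 1 -> (e <= 4)%N ->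
    reach m.+3 (0 + (4 + (e + 0))) y.
  move=> he e4; apply: reach_step => //; apply: reach_step => //.
  rewrite -addn1; apply: reach_zeros; apply: reach_step => //; apply: reach_done.
  suff -> : beta * (beta ^+ m * (beta * (beta * y - 0%:R) - 4%:R)) - e%:R =
    beta ^+ m.+3 * y - 4 * beta ^+ m.+1 - e%:R by [].
  by rewrite !exprS; ring.
(* By [yS], [dlo] and [dhi] this remainder lies in [0, 2[, so its integer part is the last digit
   [e]. The digit sum 4 + e is at most 5, whence [5 <= k]. *)
have [lt1|ge1] := ltP (beta ^+ m.+3 * y - 4 * beta ^+ m.+1) 1.
  exists (0 + (4 + (0 + 0)))%N; first by lia.
  by apply: rest => //; rewrite subr0 lt1 andbT; lra.
exists (0 + (4 + (1 + 0)))%N; first by lia.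
by apply: rest => //; apply/andP; split; lra.
Qed.

Lemma blocks_ge6 k x : (6 <= k)%N ->
  (beta - 2) ^+ 2 * beta ^+ (k - 2) <= 1 <= (beta - 2) ^+ 2 * beta ^+ k.-1 ->
  0 <= x < 1 -> exists n s, [/\ (n < k + 3)%N, (s <= n)%N & reach n.+1 s x].
Proof.
move=> k6 /andP[hi lo]; have b2 := beta2.
apply: (@block_exists k); first by lia.
  move=> y y01; exists 2, 0; split=> //; first by lia.
  (* The left-hand side is the square of beta^2 (beta - 2), which bounds the remainder after the
     digits 00. *)
  have h : (beta - 2) ^+ 2 * beta ^+ 4 <= 1.
    apply: le_trans hi; rewrite ler_wpM2l ?sqr_ge0//.
    by apply: ler_weXn2l; [lra|lia].
  apply: (@reach_zeros 2 _ 0); apply: reach_done.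
  have : beta ^+ 2 * (beta - 2) <= 1.
    rewrite -(@ler_pXn2r _ 2) ?nnegrE ?expr1n//.
      by move: h; congr (is_true (_ <= _)); ring.
    by rewrite mulr_ge0 ?sqr_ge0//; lra.
  have : 0 < beta ^+ 2 by rewrite exprn_gt0//; lra.
  by move: (beta ^+ 2) => p; nra.
move=> y; apply: trade_ones; first by lia.
rewrite lo/=; have -> : k.-1 = (k - 2).+1 by lia.
by rewrite (exprS beta) mulrCA ler_piMr//; lra.
Qed.

(* After a digit 2 the greedy digits begin with 00, 010 or 0110. *)
Lemma blocks_5 x : beta < 2289 / 1000 ->
  (beta - 2) ^+ 2 * beta ^+ 3 <= 1 <= (beta - 2) ^+ 2 * beta ^+ 4 ->
  0 <= x < 1 -> exists n s, [/\ (n < 10)%N, (s <= n)%N & reach n.+1 s x].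
Proof.
move=> bhi /andP[hi lo]; have b2 := beta2.
apply: (@block_exists 5) => //; last first.
  move=> y; apply: trade_ones => //.
  by rewrite lo/= (exprS beta) mulrCA ler_piMr//; lra.
move=> y y01.
(* The square of the left-hand side is [beta] times the quantity bounded in [hi], hence at most beta
   < 2.289 < 1.514^2. *)
have e0 : beta * (beta * (beta - 2)) < 1514 / 1000 by nra.
have h1 : 0 <= beta * y < 1 by apply/andP; split; nra.
have h2 : 0 <= beta * (beta * y) <= beta * (beta * (beta - 2)).
  by rewrite !mulr_ge0 ?ler_wpM2l//; lra.
have step0 n s z : reach n s (beta * z) -> reach n.+1 s z.
  by move=> h; rewrite -[s]add0n; apply: reach_step; rewrite ?subr0.
have step1 n s z : reach n s (beta * z - 1) -> reach n.+1 s.+1 z.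
  by move=> h; rewrite -[s.+1]add1n; apply: reach_step.
have [lt1|ge1] := ltP (beta * (beta * y)) 1.
  exists 2, 0; split=> //; apply/step0/step0/reach_done; lra.
have [z zE] : exists z, z = beta * (beta * y) - 1 by exists (beta * (beta * y) - 1).
have /andP[z0 zhi] : 0 <= z < 514 / 1000 by lra.
have h3 : 0 <= beta * z < 1178 / 1000.
  by clear -z0 zhi b2 bhi; apply/andP; split; nra.
have [zlt1|zge1] := ltP (beta * z) 1.
  exists 3, 1; split=> //; apply/step0/step1/step0/reach_done.
  by rewrite -zE; lra.
exists 4, 2; split=> //; apply/step0/step1/step1/step0/reach_done.
by rewrite -zE; clear -zge1 h3 b2 bhi; apply/andP; split; nra.
Qed.

End Blocks.

(** * Concatenating blocks into an infinite digit sequence *)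

Section DigitSequence.
Context {R : realType} (beta : R) (N : nat).
Hypotheses (beta2 : 2 < beta)
  (blocks : forall x : R, 0 <= x < 1 ->
     exists n s, [/\ (n < N)%N, (s <= n)%N & reach beta n.+1 s x]).

(* A state is (remainder, number and sum of the digits pending in the current block). *)
Let state := (R * nat * nat)%type.
Let valid (t : state) := reach beta t.1.2 t.2 t.1.1 /\ (t.1.2 <= N)%N.

(** One digit is emitted; an empty block is first refilled. The last inequality says that N (emitted
    sum + pending sum) <= (N - 1) (emitted length + pending length) is preserved. Validity is
    assumed inside the existential so that [choice] gives a total function. *)
Lemma block_step (t : state) : exists p : nat * state, valid t ->
  [/\ valid p.2, (p.1 <= 4)%N, p.2.1.1 = beta * t.1.1 - p.1%:R &
      (N * (p.1 + p.2.2) + N.-1 * t.1.2 <= N.-1 * p.2.1.2.+1 + N * t.2)%N].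
Proof.
have pos n s x : reach beta n.+1 s x -> (n < N)%N -> exists p : nat * state,
    [/\ valid p.2, (p.1 <= 4)%N, p.2.1.1 = beta * x - p.1%:R &
        (N * (p.1 + p.2.2) + N.-1 * n.+1 <= N.-1 * p.2.1.2.+1 + N * s)%N].
  move=> h nN; inversion h as [|n' s' d x' d4 rd nE sE xE].
  by exists (d, (beta * x - d%:R, n, s')); split=> //=; [split=> //=; exact: ltnW|lia].
case: t => [[x [|n]] s]; last first.
  have [[r nN]|] := EM (valid (x, n.+1, s)).
    by have [p hp] := pos _ _ _ r nN; exists p.
  by move=> nv; exists (0, (x, 0, 0))%N.
have [[/= r _]|] := EM (valid (x, 0, s)); last first.
  by move=> nv; exists (0, (x, 0, 0))%N.
inversion r as [x' x01 nE sE xE|].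
have [n [s' [nN sn rn]]] := blocks x01.
have [p [vp d4 xp hp]] := pos _ _ _ rn nN; exists p => _; split=> //=.
(* A fresh block of length n + 1 <= N and sum at most n has average at most (N - 1) / N. *)
have : (N * s' <= N.-1 * n.+1)%N by nia.
lia.
Qed.

Lemma digit_sequence (x : R) : 0 <= x < 1 ->
  exists (d : nat -> nat) (y : nat -> R), [/\ y 0 = x,
    forall i, y i.+1 = beta * y i - (d i)%:R,
    forall i, (d i <= 4)%N, forall i, 0 <= y i <= 5 &
    forall n, (N * \sum_(i < n) d i <= N.-1 * (n + N))%N].
Proof.
move=> x01; have [f fP] := choice block_step.
pose t := fix t n := if n is n'.+1 then (f (t n')).2 else (x, 0, 0) : state.
have tP n : valid (t n).
  by elim: n => [|n /fP[]//]; split=> //; exact: reach_done.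
exists (fun n => (f (t n)).1), (fun n => (t n).1.1); split=> //.
- by move=> n; have [] := fP _ (tP n).
- by move=> n; have [] := fP _ (tP n).
- by move=> n; apply: reach_bounded (proj1 (tP n)).
move=> n.
have h : (N * (\sum_(i < n) (f (t i)).1 + (t n).2) <= N.-1 * (n + (t n).1.2))%N.
  elim: n => [|n IH]; first by rewrite big_ord0 muln0.
  rewrite big_ord_recr/=; have [_ _ _] := fP _ (tP n).
  move: IH; rewrite !(addSn, mulnS, mulnDr).
  move: (N * \sum_(i < n) _)%N (N * (t n).2)%N (N.-1 * (t n).1.2)%N => a b c.
  move: (N * _)%N (N * _)%N (N.-1 * (f _).2.1.2)%N => a' b' c'; lia.
have [_ tN] := tP n.
by move: h; rewrite !mulnDr; nia.
Qed.

End DigitSequence.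

(** * Digit sums *)

Section DigitSums.
Context {R : realType}.
Implicit Types (J : option int) (m k : int) (d : int -> nat).

(** Treats finite [J] and [J = None] alike: sums over integer indices become sums over naturals
    shifted by [m]. *)
Definition starts_from J m d :=
  (forall j, m <= j -> indices J j) /\ (forall j, j < m -> d j = 0%N).

Lemma esum_starts_from J m d (g : int -> R) (K : set int) : starts_from J m d ->
  (forall j, 0 <= g j) -> K `<=` indices J ->
  \esum_(j in K) ((d j)%:R * g j)%:E =
  \esum_(i in [set i | K (m + i%:Z)]) ((d (m + i%:Z))%:R * g (m + i%:Z))%:E.
Proof.
move=> [Jm dm] g0 KJ.
have f0 j : (0 <= ((d j)%:R * g j)%:E)%E by rewrite lee_fin mulr_ge0.
rewrite (esum_mkcond K).
rewrite (_ : (fun i => _) = fun i => if i \in [set j | m <= j /\ K j] then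
   ((d i)%:R * g i)%:E else 0%E); last first.
  apply/funext => j; case: ifPn; case: ifPn => //; rewrite ?inE ?notin_setE/=.
  - move=> /not_andP[/negP|//]; rewrite -ltNge => /dm-> _.
    by rewrite mul0r.
  - by move=> [].
rewrite -esum_mkcond (reindex_esum [set i | K (m + i%:Z)] _ (fun n : nat => m + n%:Z))//.
split=> [n /= Kn|n n' _ _ /= |j /= [mj Kj]].
- by rewrite lerDl.
- by move=> /addrI [].
- by exists `|j - m|%N; rewrite /= (_ : _ + _ = j)//; lia.
Qed.

Lemma esum_indices J m d (g : int -> R) : starts_from J m d ->
  (forall j, 0 <= g j) ->
  \esum_(j in indices J) ((d j)%:R * g j)%:E =
  (\sum_(0 <= i <oo) ((d (m + i%:Z))%:R * g (m + i%:Z))%:E)%E.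
Proof.
move=> md g0; have [Jm _] := md.
rewrite nneseries_esumT; last by move=> i; rewrite lee_fin mulr_ge0.
rewrite (esum_starts_from md)//; congr esum.
by apply/seteqP; split=> //= i _; apply: Jm; rewrite lerDl.
Qed.

Lemma esum_indices_upto J m d (g : int -> R) n : starts_from J m d ->
  (forall j, 0 <= g j) ->
  \esum_(j in indices_upto J (m + n%:Z)) ((d j)%:R * g j)%:E =
  (\sum_(i < n.+1) (d (m + i%:Z))%:R * g (m + i%:Z))%:E.
Proof.
move=> md g0; have [Jm _] := md.
rewrite (esum_starts_from md)//; last by move=> j [].
rewrite (_ : [set i | _] = `I_n.+1); last first.
  apply/seteqP; split=> [i [_] /=|i /= ni]; first by lia.
  by split; [apply: Jm; rewrite lerDl|lia].
rewrite esum_fset//; last by move=> i _; rewrite lee_fin mulr_ge0.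
by rewrite -fsbig_ord sumEFin.
Qed.

(** [limn_esup] is an infimum of suprema over eventual sets; the set where u k <= l + e is one of
    them. *)
Lemma limn_esup_le_near (u : (\bar R)^nat) (l : R) :
  (forall e : R, 0 < e -> \forall k \near \oo, (u k <= (l + e)%:E)%E) ->
  (limn_esup u <= l%:E)%E.
Proof.
move=> h; apply/lee_addgt0Pr => e e0; rewrite -EFinD.
apply: ge_ereal_inf; exists (ereal_sup (u @` [set k | (u k <= (l + e)%:E)%E])).
  by exists [set k | (u k <= (l + e)%:E)%E] => //; exact: h.
by apply: ge_ereal_sup => _ [k /= uk <-].
Qed.

Lemma limn_esup_ge_near (u : (\bar R)^nat) (l : R) :
  (forall e : R, 0 < e -> \forall k \near \oo, ((l - e)%:E <= u k)%E) ->
  (l%:E <= limn_esup u)%E.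
Proof.
move=> h; apply: le_ereal_inf_tmp => _ /= [V Vf <-].
apply/lee_addgt0Pr => e e0; rewrite -leeBlDr// -EFinB.
have [k [/= Vk hk]] := filter_ex (filterI Vf (h e e0)).
by apply: le_trans hk _; apply: ereal_sup_ubound; exists k.
Qed.

Lemma esum_digits J m d (k : nat) : starts_from J m d -> m <= k%:Z ->
  \esum_(j in indices_upto J k) ((d j)%:R : R)%:E =
  (\sum_(i < (`|k - m|).+1) d (m + i%:Z)%R)%:R%:E.
Proof.
move=> md mk; have -> : indices_upto J k%:Z = indices_upto J (m + `|k - m|%N%:Z).
  by congr indices_upto; lia.
under eq_esum do rewrite -[(d _)%:R]mulr1.
rewrite (esum_indices_upto _ md (g := fun=> 1))//= natr_sum.
by under eq_bigr do rewrite mulr1.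
Qed.

Lemma natr_distS m (k : nat) : m <= k%:Z ->
  (`|k - m|.+1)%:R = k%:R - m%:~R + 1 :> R.
Proof.
move=> mk; rewrite -addn1 natrD; congr (_ + _).
by rewrite !pmulrn -rmorphB/=; congr (_%:~R); lia.
Qed.

Lemma near_divn_le (C e : R) : 0 < e ->
  \forall k \near \oo, (0 < k)%N /\ C * k%:R^-1 <= e.
Proof.
move=> e0; near=> k.
have k0 : (0 < k)%N by near: k; exact: nbhs_infty_gt.
split=> //; rewrite ler_pdivrMr ?ltr0n// -ler_pdivrMl//.
by near: k; exact: nbhs_infty_ger.
Unshelve. all: by end_near. Qed.

Lemma upper_average_le J m d (C a : R) : starts_from J m d ->
  (forall n, (\sum_(i < n) d (m + i%:Z)%R)%:R <= C + a * n%:R) ->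
  (upper_average R J d <= a%:E)%E.
Proof.
move=> md h; apply: limn_esup_le_near => e e0.
(* There are k - m + 1 digits up to index [k]; the constant collects all of C + a (k - m + 1) except
   a k. *)
apply: filterS (filterI (near_divn_le (C + a * (1 - m%:~R)) e0) (nbhs_infty_ge `|m|%N)).
move=> k [[k0 ke] /= mk']; have mk : m <= k%:Z by lia.
rewrite (esum_digits md mk) -EFinM lee_fin.
rewrite ler_pdivrMl ?ltr0n//.
apply: le_trans (h _) _.
rewrite natr_distS//.
have k0' : 0 < k%:R :> R by rewrite ltr0n.
by move: ke; rewrite ler_pdivrMr//; lra.
Qed.

Lemma upper_average_ones_ge1 J m d : starts_from J m d ->
  (forall n : nat, d (m + n%:Z) = 1%N) ->
  (1%:E <= upper_average R J d)%E.
Proof.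
move=> md h; apply: limn_esup_ge_near => e e0.
apply: filterS (filterI (near_divn_le m%:~R e0) (nbhs_infty_ge `|m|%N)).
move=> k [[k0 ke] /= mk']; have mk : m <= k%:Z by lia.
rewrite (esum_digits md mk) -EFinM lee_fin.
rewrite ler_pdivlMl ?ltr0n//.
under eq_bigr do rewrite h.
rewrite sum1_card card_ord.
rewrite natr_distS//.
have k0' : 0 < k%:R :> R by rewrite ltr0n.
by move: ke; rewrite ler_pdivrMr//; lra.
Qed.

End DigitSums.

(** * Expansions and remainders *)

Section Expansions.
Context {R : realType} (beta : R).
Hypothesis beta1 : 1 < beta.
Implicit Types (J : option int) (m k : int) (d : int -> nat) (y : nat -> R) (u : R).

Let beta0 : 0 < beta. Proof. exact: lt_trans beta1. Qed.

Lemma exprz_addS m (n : nat) : beta ^ (m + n.+1%:Z) = beta ^ (m + n%:Z) * beta.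
Proof. by rewrite intS addrCA expfzDr ?gt_eqF// expr1z mulrC. Qed.

(* [y n] is [beta ^ (m + n - 1)] times what is left of u before the digit of index m + n. *)
Definition orbit_from m d u y :=
  u = y 0 * beta / beta ^ m /\
  forall i, y i.+1 = beta * y i - (d (m + i%:Z))%:R.

Lemma orbit_from_exists m d u : exists y, orbit_from m d u y.
Proof.
pose y := fix y n := if n is n'.+1 then beta * y n' - (d (m + n'%:Z))%:R
                     else u * beta ^ m / beta.
exists y; split=> //=.
by rewrite divfK ?mulfK ?gt_eqF// exprz_gt0.
Qed.

(** The sum telescopes, each digit being beta y_i - y_(i+1). *)
Lemma orbit_partial_sum m d u y n : orbit_from m d u y ->
  \sum_(i < n) (d (m + i%:Z))%:R / beta ^ (m + i%:Z) =
  u - y n * beta / beta ^ (m + n%:Z).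
Proof.
move=> [-> yS]; elim: n => [|n IH].
  by rewrite big_ord0 addr0 subrr.
rewrite big_ord_recr/= IH yS exprz_addS.
by field; rewrite !gt_eqF ?exprz_gt0.
Qed.

Lemma orbit_remainder J m d u y n : starts_from J m d -> orbit_from m d u y ->
  remainder J beta u d (m + n%:Z) = (y n.+1 / beta ^ (m + n%:Z))%:E.
Proof.
move=> md yP; rewrite /remainder.
rewrite (esum_indices_upto (g := fun j => (beta ^ j)^-1) _ md); last first.
  by move=> j; rewrite invr_ge0 ltW// exprz_gt0.
rewrite (orbit_partial_sum _ yP) -EFinB; congr EFin.
rewrite exprz_addS.
by field; rewrite !gt_eqF ?exprz_gt0.
Qed.

(** A bounded orbit, greedy or not, leaves a remainder that decays geometrically. *)
Lemma orbit_expansion_sum J m d u y (B : R) : starts_from J m d ->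
  orbit_from m d u y -> (forall n, 0 <= y n <= B) ->
  u%:E = expansion_sum J beta d.
Proof.
move=> md yP yB; rewrite /expansion_sum.
rewrite (esum_indices (g := fun j => (beta ^ j)^-1) md); last first.
  by move=> j; rewrite invr_ge0 ltW// exprz_gt0.
apply/esym/cvg_lim => //.
under eq_fun do rewrite sumEFin big_mkord (orbit_partial_sum _ yP).
apply: cvg_EFin; first by near=> n.
rewrite (_ : _ \o _ = fun n => u - y n * beta / beta ^ (m + n%:Z)); last by [].
rewrite -[X in _ --> X]subr0; apply: cvgB; first exact: cvg_cst.
apply: (squeeze_cvgr (f := fun=> 0) (h := fun n => B * beta / beta ^ m * beta^-1 ^+ n)).
- near=> n; have /andP[y0 yB'] := yB n.
  have bpos (k : int) : 0 < beta ^ k by exact: exprz_gt0.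
  rewrite divr_ge0 ?mulr_ge0 ?(ltW (bpos _)) ?(ltW beta0)//=.
  rewrite expfzDr ?gt_eqF// invfM exprVn mulrA.
  by rewrite !ler_pM2r ?invr_gt0 ?exprn_gt0 ?exprz_gt0.
- exact: cvg_cst.
- rewrite -[X in _ --> X](mulr0 (B * beta / beta ^ m)).
  apply: cvgM; first exact: cvg_cst.
  by apply: cvg_expr; rewrite ger0_norm ?invr_ge0 ?ltW// invf_lt1.
Unshelve. all: by end_near. Qed.

End Expansions.

(** * Greedy expansions *)

Section BetaExpansions.
Context {R : realType} (beta : R).
Hypothesis beta2 : 2 < beta.
Implicit Types (J : option int) (m k : int) (d : int -> nat) (y : nat -> R) (u : R).

Let beta0 : 0 < beta. Proof. by have := beta2; lra. Qed.
Let beta1 : 1 < beta. Proof. by have := beta2; lra. Qed.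

(** For [J = None], a nonzero digit at [j] contributes at least beta^(-j), which exceeds [u] once
    [j] is very negative and would make the remainder negative. *)
Lemma beta_expansion_starts J u d :
  is_beta_expansion J beta u d -> exists m, starts_from J m d.
Proof.
case: J => [j0|] [sup _ rem].
  exists j0; split=> // j jj0; apply: sup => /=; apply/negP; by rewrite -ltNge.
have [n un] : exists n : nat, u < beta ^+ n.
  exists (Num.Def.archi_bound u); apply: lt_le_trans (upper_nthrootP (leqnn _)) _.
  by rewrite lerXn2r ?nnegrE// ltW.
exists (- n%:Z); split=> // j jn; apply/eqP; rewrite -leqn0 leqNgt; apply/negP => dj.
have /andP[] := rem j I; rewrite /remainder sube_ge0 ?orbT//.
move=> + _; apply/negP; rewrite -ltNge.
apply: (@lt_le_trans _ _ (beta ^ (- j))%:E).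
  rewrite lte_fin; apply: lt_le_trans un _.
  by rewrite exprnP ler_weXz2l; lia || exact: ltW.
apply: esum_ge; exists [set j]; first by split=> // _ ->.
rewrite fsbig_set1 lee_fin -invr_expz ler_peMl ?ler1n//.
by rewrite invr_ge0 ltW// exprz_gt0.
Qed.

(** The greedy condition constrains the orbit only after the first digit: [y 0] may exceed 1. *)
Lemma beta_expansion_orbit J m u d y n : starts_from J m d -> orbit_from beta m d u y ->
  is_beta_expansion J beta u d -> 0 <= y n.+1 < 1.
Proof.
move=> md yP [_ _ rem]; have [Jm _] := md.
have := rem (m + n%:Z); rewrite (orbit_remainder _ _ md yP)// lee_fin lte_fin.
have bp : 0 < beta ^ (m + n%:Z) by exact: exprz_gt0.
rewrite -invr_expz -[X in _ < X]mul1r ltr_pM2r ?invr_gt0//.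
by rewrite pmulr_lge0 ?invr_gt0//; apply; apply: Jm; rewrite lerDl.
Qed.

(** From a common start, equal remainders force equal digits: the next remainders both lie in [0,
    1[, so the digits differ by less than 1. *)
Lemma beta_expansion_unique J u d d' :
  is_beta_expansion J beta u d -> is_beta_expansion J beta u d' -> d = d'.
Proof.
move=> de de'; have [m1 md] := beta_expansion_starts de.
have [m2 md'] := beta_expansion_starts de'.
wlog m12 : d d' m1 m2 de de' md md' / m1 <= m2.
  move=> h; have [?|/ltW ?] := leP m1 m2; first exact: (h _ _ m1 m2).
  by apply/esym; exact: (h _ _ m2 m1).
have {m2 md' m12}md' : starts_from J m1 d'.
  by split; [case: md|move=> j jm1; apply: (proj2 md'); exact: lt_le_trans m12].
have [y yP] := orbit_from_exists beta1 m1 d u.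
have [y' yP'] := orbit_from_exists beta1 m1 d' u.
have y0 : y 0%N = y' 0%N.
  have [+ _] := yP; have [-> _] := yP'.
  by move=> /divIf/mulIf-> //; rewrite gt_eqF ?exprz_gt0.
have digit n : y n = y' n -> d (m1 + n%:Z) = d' (m1 + n%:Z).
  move=> yn; have := beta_expansion_orbit n md yP de.
  have := beta_expansion_orbit n md' yP' de'.
  have [_ ->] := yP; have [_ ->] := yP'; rewrite yn => h h'.
  have h1 : (d (m1 + n%:Z))%:R < (d' (m1 + n%:Z)).+1%:R :> R by rewrite -natr1; lra.
  have h2 : (d' (m1 + n%:Z))%:R < (d (m1 + n%:Z)).+1%:R :> R by rewrite -natr1; lra.
  by move: h1 h2; rewrite !ltr_nat; lia.
have yy' n : y n = y' n.
  elim: n => // n IH; have [_ ->] := yP; have [_ ->] := yP'.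
  by rewrite IH digit.
apply/funext => j; have [jm|mj] := ltP j m1.
  by rewrite (proj2 md)// (proj2 md').
have -> : j = m1 + `|j - m1|%N%:Z by lia.
exact: digit.
Qed.

Definition ones_from m : int -> nat := fun j => (m <= j)%R : nat.

Lemma ones_from_starts J : starts_from J (odflt 0 J) (ones_from (odflt 0 J)).
Proof. by case: J => [j0|]; split=> // j jm; rewrite /ones_from leNgt jm. Qed.

(** The orbit is constant: 1 / (beta - 1) is the fixed point of y -> beta y - 1, and it is below 1
    as beta > 2. *)
Lemma ones_from_beta_expansion J (m := odflt 0 J) :
  is_beta_expansion J beta ((beta - 1)^-1 * beta / beta ^ m) (ones_from m).
Proof.
have md := ones_from_starts J; have [Jm dm] := md.
set u := (_ / _); pose y (n : nat) := (beta - 1)^-1.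
have b2 := beta2.
have y01 n : 0 <= y n < 1.
  by rewrite /y invr_ge0 invf_lt1 ?subr_gt0//; apply/andP; split; lra.
have yP : orbit_from beta m (ones_from m) u y.
  split=> // i; rewrite /ones_from lerDl /= /y.
  by field; apply/eqP; lra.
have u0 : 0 <= u by rewrite /u !mulr_ge0 ?invr_ge0 ?(ltW (exprz_gt0 _ _))//; lra.
split.
- by move=> j nj; rewrite dm// ltNge; apply/negP => /Jm.
- by apply: (orbit_expansion_sum beta1 md yP (B := 1)) => n; have := y01 n; lra.
move=> k Jk; have [mk|km] := leP m k.
  have -> : k = m + `|k - m|%N%:Z by lia.
  rewrite (orbit_remainder _ _ md yP)// lee_fin lte_fin.
  have bp : 0 < beta ^ (m + `|k - m|%N%:Z) by exact: exprz_gt0.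
  have /andP[y0 y1] := y01 `|k - m|%N.+1.
  by rewrite -invr_expz divr_ge0 ?(ltW bp)//= -[X in _ < X]mul1r ltr_pM2r ?invr_gt0.
(* An index k < m occurs only for [J = None], where m = 0; the remainder is then u = beta / (beta -
   1) < beta <= beta^(-k). *)
rewrite /remainder esum1; last first.
  by move=> j [_ jk]; rewrite dm ?mul0r// (le_lt_trans jk).
rewrite sube0 lee_fin lte_fin u0/=.
move: Jk km; rewrite /u /m; case: J {m md Jm dm u y01 yP u0 y} => [j0|] /=.
  by rewrite leNgt => /negP.
move=> _ k0; rewrite expr0z divr1.
apply: (@lt_le_trans _ _ beta).
  by rewrite gtr_pMl// invf_lt1 ?subr_gt0//; lra.
have -> : - k = (`|k|.-1).+1 by lia.
by rewrite -exprnP exprS ler_peMr ?exprn_ege1 ?(ltW beta1) ?(ltW beta0).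
Qed.

Lemma greedy_sum_le (y : nat -> R) (a : nat -> nat) n :
  beta ^+ 2 - 2 * beta <= 1 ->
  (forall i, 0 <= y i < 1) -> (forall i, y i.+1 = beta * y i - (a i)%:R) ->
  (\sum_(i < n) a i <= n.+1)%N.
Proof.
move=> b12 y01 yS.
have b2 := beta2.
have a2 i : (a i <= 2)%N.
  rewrite -ltnS -(ltr_nat R); have := yS i; have := y01 i; have := y01 i.+1.
  by move: (a i)%:R => c; nra.
have a20 i : a i = 2%N -> a i.+1 = 0%N.
  move=> ai; apply/eqP; rewrite -leqn0 -ltnS -(ltr_nat R).
  have := yS i.+1; have := yS i; rewrite ai; have := y01 i; have := y01 i.+1.
  have := y01 i.+2; move: (a i.+1)%:R => c; nra.
case: n => [|n]; first by rewrite big_ord0.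
(* Each 2 is compensated by the 0 after it, so an excess of 1 survives only when the last digit is
   2. *)
suff : (\sum_(i < n.+1) a i <= n.+1 + (a n == 2%N))%N.
  by move=> h; apply: leq_trans h _; rewrite -[leqRHS]addn1 leq_add2l leq_b1.
elim: n => [|n IH]; first by rewrite big_ord1; case: (a 0) (a2 0%N) => [|[|[|]]].
rewrite big_ord_recr/=; move: IH (a2 n.+1) (a20 n).
move: (\sum_(i < n.+1) a i)%N => s.
by case: (a n =P 2%N) => an; case: (a n.+1 =P 2%N) => an1; lia.
Qed.

Lemma dbar_betaE_eq1 J : beta ^+ 2 - 2 * beta <= 1 -> dbar_betaE J beta = 1%:E.
Proof.
move=> b12; apply/eqP; rewrite eq_le; apply/andP; split.
  apply: ge_ereal_sup => _ [u /= u0 <-].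
  have [[d de]|nex] := EM (exists d, is_beta_expansion J beta u d); last first.
    (* Where no expansion exists, [get] returns the default point, the zero sequence. *)
    have -> : beta_digits J beta u = fun=> 0%N.
      by rewrite /beta_digits getPN// => d de; apply: nex; exists d.
    apply: (@upper_average_le _ _ (odflt 0 J) _ 0).
      by split=> // j; case: J {nex} => //.
    by move=> n; rewrite big1// mulr0n add0r mul1r.
  have {d de} := getI de; rewrite -/(beta_digits J beta u).
  move: (beta_digits _ _ _) => d de.
  have [m md] := beta_expansion_starts de.
  have [y yP] := orbit_from_exists beta1 m d u.
  have y01 n := beta_expansion_orbit n md yP de.
  (* The first digit can be large, so it goes into the additive constant. *)
  apply: (@upper_average_le _ _ m _ (d m)%:R) => // -[|n].
    by rewrite big_ord0 mulr0 addr0 ler0n.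
  rewrite big_ord_recl addr0 mul1r -natrD ler_nat leq_add2l.
  under eq_bigr do rewrite lift0.
  apply: (greedy_sum_le (y := fun i => y i.+1)
    (a := fun i => d (m + i.+1%:Z))) => // i.
  by rewrite (proj2 yP).
pose m := odflt 0 J.
have de := ones_from_beta_expansion J; rewrite -/m in de.
apply: (@le_trans _ _ (upper_average R J (ones_from m))).
  apply: (upper_average_ones_ge1 (ones_from_starts J)) => n.
  by rewrite /ones_from lerDl.
apply: ereal_sup_ubound; exists ((beta - 1)^-1 * beta / beta ^ m) => /=.
  by rewrite !mulr_gt0 ?invr_gt0 ?exprz_gt0// subr_gt0.
congr upper_average; apply: beta_expansion_unique (getI de) de.
Qed.

End BetaExpansions.

(** * Bounded expansions *)

(** The first digit absorbs the integer part of the scaled [u], and blocks take over from the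
    fractional part; a single digit does not affect the average. *)
Lemma dbar_bdd_le (R : realType) (beta : R) (N : nat) J : 2 < beta ->
  (forall x : R, 0 <= x < 1 ->
     exists n s, [/\ (n < N)%N, (s <= n)%N & reach beta n.+1 s x]) ->
  (dbar_bdd J beta <= (N.-1%:R / N%:R)%:E)%E.
Proof.
move=> b2 blocks; have b0 : 0 < beta by lra.
have [_ [_ [/(leq_ltn_trans (leq0n _)) N0 _ _]]] := blocks 0 ltac:(by rewrite lexx ltr01).
apply: ge_ereal_sup => _ [u /= u0 <-].
pose m := odflt 0 J; pose z := u * beta ^ m; pose a0 := Num.truncn z.
have z0 : 0 <= z by rewrite mulr_ge0 ?ltW// exprz_gt0.
have z01 : 0 <= z - a0%:R < 1.
  by have := truncn_itv z0; rewrite -/a0 -natr1; lra.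
have [a [y [y0 yS a4 yB aN]]] := digit_sequence b2 blocks z01.
pose e n := if n is n'.+1 then a n' else a0.
pose d (j : int) := if m <= j then e `|j - m|%N else 0%N.
have de n : d (m + n%:Z) = e n by rewrite /d lerDl /= addrAC subrr add0r.
have md : starts_from J m d.
  split=> [j|j jm]; last by rewrite /d leNgt jm.
  by rewrite /m; case: J {m z a0 z0 z01 y0 e d de}.
pose t n := if n is n'.+1 then y n' else z / beta.
have tP : orbit_from beta m d u t.
  split; first by rewrite /= divfK ?mulfK ?gt_eqF ?exprz_gt0.
  move=> [|n]; rewrite de /= ?yS//.
  by rewrite y0 mulrC divfK ?gt_eqF.
have zb0 : 0 <= z / beta by rewrite divr_ge0 ?(ltW b0).
have usum : u%:E = expansion_sum J beta d.
  apply: (orbit_expansion_sum _ md tP (B := 5 + z / beta)); first by lra.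
  by case=> [|n] /=; [|have := yB n]; lra.
apply: ge_ereal_inf; exists (upper_average R J d).
  exists d => //; split=> //; split.
  - by move=> j nj; apply: (proj2 md); rewrite ltNge; apply/negP => /(proj1 md).
  - exists (a0 + 4)%N => j; rewrite /d; case: ifP => // _.
    by case: `|_|%N => [|n] /=; [exact: leq_addr|exact/(leq_trans (a4 n))/leq_addl].
  - move=> J0; rewrite (_ : [set j | _] = set0)//; apply/seteqP; split=> // j /= [j0].
    by apply; rewrite (proj2 md)// /m J0.
(* Dividing N sum <= (N - 1) (n + N) by [N] leaves the constant N - 1, to which the first digit [a0]
   is added. *)
apply: (upper_average_le (C := a0%:R + N.-1%:R) md) => -[|n].
  by rewrite big_ord0 mulr0 addr0 addr_ge0.
rewrite big_ord_recl de.
under eq_bigr do rewrite lift0 de/=.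
have N0' : 0 < N%:R :> R by rewrite ltr0n.
rewrite natrD -addrA lerD2l -(ler_pM2l N0') mulrDr [N.-1%:R / _]mulrC -mulrA mulVKf ?gt_eqF//.
rewrite -!natrM -natrD ler_nat; apply: leq_trans (aN n) _.
by rewrite mulnDr mulnS mulnC; lia.
Qed.

Theorem theorem2 (R : realType) :
  (forall k : nat, (5 <= k)%N ->
     exists! x : R, 2 < x /\ gamma_equation k x) /\
  `|gamma R 5 - (2 + 288 / 10 ^+ 3 + 79 / 10 ^+ 5)| < 5 / 10 ^+ 6 /\
  (forall (J : option int) (beta : R),
     (2 < beta < gamma R 5 -> dbar_betaE J beta = 1%:E) /\
     (gamma R 6 <= beta <= gamma R 5 ->
        (dbar_bdd J beta <= (9 / 10)%:E)%E) /\
     (forall k : nat, (6 <= k)%N -> gamma R k.+1 <= beta <= gamma R k ->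
        (dbar_bdd J beta <= ((k + 2)%:R / (k + 3)%:R)%:E)%E)).
Proof.
have g5 : gamma R 5 < 2289 / 1000.
  by have := @gamma5_approx R; rewrite ltr_norml => /andP[_]; lra.
split; first by case=> [|[|k]] // _; exact: gamma_exists_unique.
split; first exact: gamma5_approx.
move=> J beta; split; last split.
- move=> /andP[b2 bg]; apply: dbar_betaE_eq1 => //.
  have b_lt : beta < 2289 / 1000 by lra.
  (* The bound 2.289 lies below 1 + sqrt 2, the positive root of x^2 - 2 x = 1. *)
  by nra.
- move=> /andP[g6b bg5]; have b2 : 2 < beta by apply: lt_le_trans g6b; exact: gamma_gt2.
  apply: (@dbar_bdd_le _ _ 10) => // x; apply: blocks_5 => //; [lra|lra|].
  by move: g6b bg5; rewrite (gamma_leE _ (ltW b2)) (le_gammaE _ (ltW b2)) => -> ->.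
- move=> [|[|k]] // k6 /andP[gkb bgk].
  have b2 : 2 < beta by apply: lt_le_trans gkb; exact: gamma_gt2.
  have b3 : beta <= 3.
    rewrite (le_trans bgk)// gamma_leE; last by lra.
    have -> : 3 - 2 = 1 :> R by lra.
    by rewrite expr1n mul1r exprn_ege1//; lra.
  have -> : ((k.+2 + 2)%:R / (k.+2 + 3)%:R)%:E = ((k.+2 + 3).-1%:R / (k.+2 + 3)%:R)%:E :> \bar R.
    by rewrite !addnS.
  apply: dbar_bdd_le => // x; apply: blocks_ge6 => //.
  by move: gkb bgk; rewrite (gamma_leE _ (ltW b2)) (le_gammaE _ (ltW b2)) subn2/= => -> ->.
Qed.
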